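(* Let $\mathscr{L}_1$ and $\mathscr{L}_2$ be bounded distributive lattices, let $S \subseteq \mathscr{L}_1$ be $\vee$-closed, and let $\psi : \mathscr{L}_1 \rightarrow \mathscr{L}_2$ be a lattice homomorphism such that $\psi(1) = 1$. The following hold: (1) If $\mathfrak{q}_2$ is a $\psi(S)$-filter of $\mathscr{L}_2$, then $\psi^{-1}(\mathfrak{q}_2)$ is an $S$-filter of $\mathscr{L}_1$. (2) If $\mathscr{L}_1$ is complemented, $\psi$ is onto, and $\mathfrak{q}_1$ is an $S$-filter of $\mathscr{L}_1$ containing $\operatorname{Ker}(\psi)$, then $\psi(\mathfrak{q}_1)$ is a $\psi(S)$-filter of $\mathscr{L}_2$.
   Context: A bounded lattice has a least element $0$ and a greatest element $1$. A filter of a lattice $\mathscr{L}$ is a non-empty subset $F \subseteq \mathscr{L}$ such that $u \wedge v \in F$ for all $u,v \in F$, and $u \in F$, $w \in \mathscr{L}$, $u \le w$ imply $w \in F$; it is proper if $F \ne \mathscr{L}$. A subset $S \subseteq \mathscr{L}$ is $\vee$-closed if $0 \in S$ and $s_1 \vee s_2 \in S$ for all $s_1,s_2 \in S$. A proper filter $\mathfrak{q}$ of $\mathscr{L}$ is an $S$-filter if for all $u,v \in \mathscr{L}$, $u \vee v \in \mathfrak{q}$ and $u \in S$ imply $v \in \mathfrak{q}$; likewise, with $\psi(S) = \{\psi(s) \mid s \in S\}$, a $\psi(S)$-filter of $\mathscr{L}_2$ is a proper filter $\mathfrak{q}$ of $\mathscr{L}_2$ such that for all $u,v \in \mathscr{L}_2$,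 $u \vee v \in \mathfrak{q}$ and $u \in \psi(S)$ imply $v \in \mathfrak{q}$. A lattice homomorphism is a map $\psi$ with $\psi(u \vee v) = \psi(u) \vee \psi(v)$ and $\psi(u \wedge v) = \psi(u) \wedge \psi(v)$ for all $u,v$ (preservation of $0$ is not required). $\operatorname{Ker}(\psi) = \{u \in \mathscr{L}_1 \mid \psi(u) = 1\}$. A lattice is complemented if every element $u$ has some $v$ with $u \vee v = 1$ and $u \wedge v = 0$. *)

(* Defs.v *)
From mathcomp Require Import all_boot all_order.
From mathcomp Require Import classical_sets.

Set Implicit Arguments.
Unset Strict Implicit.
Unset Printing Implicit Defensive.

Local Open Scope classical_set_scope.

Definition lattice_filter d (L : latticeType d) (F : set L) : Prop :=
  [/\ F !=set0,
      (forall u v : L, F u -> F v -> F (u `&` v)%O)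
    & (forall u w : L, F u -> (u <= w)%O -> F w)].

Definition proper_lattice_filter d (L : latticeType d) (F : set L) : Prop :=
  lattice_filter F /\ F <> [set: L].

Definition vee_closed d (L : bLatticeType d) (S : set L) : Prop :=
  S \bot%O /\ (forall s1 s2 : L, S s1 -> S s2 -> S (s1 `|` s2)%O).

(* S is an arbitrary subset here, because the notion is also used for the image
   of a join-closed set under a homomorphism that need not preserve \bot. *)
Definition S_filter d (L : latticeType d) (S q : set L) : Prop :=
  proper_lattice_filter q /\
  (forall u v : L, q (u `|` v)%O -> S u -> q v).

Definition lattice_Ker d1 d2 (L1 : latticeType d1) (L2 : tLatticeType d2)
    (psi : L1 -> L2) : set L1 :=
  [set u : L1 | psi u = \top%O].

Definition complemented d (L : tbLatticeType d) : Prop :=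
  forall u : L, exists v : L, (u `|` v)%O = \top%O /\ (u `&` v)%O = \bot%O.

(* Main.v *)
Require Import Defs.
From mathcomp Require Import all_boot all_order.
From mathcomp Require Import classical_sets.

Import Order.TTheory.
Local Open Scope classical_set_scope.

(** Part (1) is formal except for properness.  As [psi] need not preserve
    [\bot], a preimage equal to [L1] only says that [psi \bot] lies in [q2];
    but [psi \bot] is in [psi(S)], so the cancellation property of
    a [psi(S)]-filter then puts every [v] into [q2] (because [psi \bot `|` v]
    is in [q2]), contradicting that [q2] is proper.

    Part (2) rests on [ker_filter_reflects]: in a complemented lattice, a filter
    [q] containing the kernel satisfies [psi b <= psi a -> q b -> q a].  Hence
    [psi a] lies in [psi(q)] only if [a] lies in [q], and, [psi] being onto,
    each condition on [psi(q)] is read off from the same condition on [q]. *)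

Lemma filter_top d (L : tLatticeType d) (F : set L) :
  lattice_filter F -> F \top%O.
Proof. by case=> -[x Fx] _ Fup; exact: Fup Fx (lex1 x). Qed.

Lemma preimage_filter d1 d2 (L1 : tLatticeType d1) (L2 : tLatticeType d2)
    (psi : {lmorphism L1 -> L2}) (F : set L2) :
  psi \top%O = \top%O -> lattice_filter F -> lattice_filter (psi @^-1` F).
Proof.
move=> psi1 FF; have F1 := filter_top _ _ _ FF; case: FF => _ FI Fup; split.
- by exists \top%O; rewrite /preimage /= psi1.
- by move=> u v Fu Fv; rewrite /preimage /= omorphI; exact: FI.
- by move=> u w Fu leuw; apply: Fup Fu _; exact: omorph_le.
Qed.

(** If [s] were in [q], then so would [s `|` v] for every [v], and cancelling
    [s] would put [v] in the proper filter [q]. *)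
Lemma S_filter_disjoint d (L : latticeType d) (S q : set L) (s : L) :
  S_filter S q -> S s -> ~ q s.
Proof.
case=> -[[_ _ qup] qT] qS Ss qs; apply: qT; rewrite -subTset => v _.
by apply: (qS s v) => //; exact: qup qs (leUl s v).
Qed.

(** If [b'] is a complement of [b], then [psi (b' `|` a)] dominates
    [psi (b' `|` b)], which is [\top]; so [b' `|` a] is in the kernel, hence
    in [q].  Meeting it with [b] stays in [q] and leaves [b `&` a], by
    distributivity. *)
Lemma ker_filter_reflects d1 d2 (L1 : tbDistrLatticeType d1)
    (L2 : tLatticeType d2) (psi : {lmorphism L1 -> L2}) (q : set L1) :
    psi \top%O = \top%O -> complemented L1 ->
    lattice_filter q -> lattice_Ker psi `<=` q ->
  forall a b : L1, (psi b <= psi a)%O -> q b -> q a.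
Proof.
move=> psi1 cL1 [_ qI qup] kerq a b leba qb; have [b' [bUb' bIb']] := cL1 b.
have q_b'a : q (b' `|` a)%O.
  apply: kerq; apply/eqP; rewrite -le1x -psi1 -bUb' !omorphU leUx.
  by rewrite leUl andbT (le_trans leba) ?leUr.
apply: (qup (b `&` (b' `|` a))%O); first exact: qI.
by rewrite meetUr bIb' join0x leIr.
Qed.

Theorem theorem3p14 (d1 d2 : Order.disp_t)
    (L1 : tbDistrLatticeType d1) (L2 : tbDistrLatticeType d2)
    (S : set L1) (psi : {lmorphism L1 -> L2})
    (hS : vee_closed S) (psi1 : psi \top%O = \top%O) :
  (forall q2 : set L2, S_filter (psi @` S) q2 -> S_filter S (psi @^-1` q2)) /\
  (complemented L1 -> range psi = [set: L2] ->
    forall q1 : set L1, S_filter S q1 -> lattice_Ker psi `<=` q1 ->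
      S_filter (psi @` S) (psi @` q1)).
Proof.
split=> [q2 q2S | cL1 psi_onto q1 [[q1F q1T] q1S] kerq1].
  have [[q2F _] q2cancel] := q2S; split; first split.
  - exact: preimage_filter.
  - move=> preT; apply: (S_filter_disjoint _ _ _ _ (psi \bot%O) q2S).
      by exists \bot%O => //; case: hS.
    by have : (psi @^-1` q2) \bot%O by rewrite preT.
  - move=> u v; rewrite /preimage /= omorphU => q2uv Su.
    by apply: q2cancel q2uv _; exists u.
have reflects := ker_filter_reflects _ _ _ _ _ _ psi1 cL1 q1F kerq1.
have image_q1 a : (psi @` q1) (psi a) -> q1 a.
  by case=> b q1b eqba; apply: reflects q1b; rewrite eqba.
have lift y : exists a, psi a = y.
  by have [a _ <-] : range psi y by [rewrite psi_onto]; exists a.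
split; first split.
- split.
  + by exists (psi \top%O), \top%O => //; exact: filter_top.
  + move=> _ _ [a q1a <-] [b q1b <-]; exists (a `&` b)%O; last exact: omorphI.
    by case: q1F => _ q1I _; exact: q1I.
  + move=> _ w [b q1b <-]; have [a <-] := lift w => leba.
    by exists a => //; exact: reflects leba q1b.
- move=> imT; apply: q1T; rewrite -subTset => a _.
  by apply: image_q1; rewrite imT.
- move=> u v q1uv [s Ss eqs]; have [t eqt] := lift v.
  move: q1uv; rewrite -eqs -eqt -omorphU => /image_q1 q1st.
  by exists t => //; exact: q1S q1st Ss.
Qed.
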